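(* Let $L>0$, $0<\gamma<1$, $\alpha>0$, let $K\ge 1$ be an integer and $\Delta t>0$, and put $\beta=\Gamma(2-\gamma)\,\Delta t^{\gamma}$ and $b_j=(j+1)^{1-\gamma}-j^{1-\gamma}$ for $j\ge 0$. Let $y^0\in L^2(0,L)$ and $u^1,\dots,u^{K}\in L^2(0,L)$. Suppose $y^1,\dots,y^{K}\in H_0^2(0,L)$ have $y^{j}_{xxxx}\in L^2(0,L)$ and satisfy, for every $g\in H_0^2(0,L)$, $$\langle y^{1},g\rangle+\beta\alpha\langle y^{1}_{xxxx},g\rangle=\langle y^{0},g\rangle+\beta\langle u^{1},g\rangle,$$ and, for $p=1,\dots,K-1$, $$\langle y^{p+1},g\rangle+\beta\alpha\langle y^{p+1}_{xxxx},g\rangle=(1-b_1)\langle y^{p},g\rangle+\sum_{j=1}^{p-1}(b_j-b_{j+1})\langle y^{p-j},g\rangle+b_p\langle y^{0},g\rangle+\beta\langle u^{p+1},g\rangle .$$ Then, for every $\Delta t>0$ (unconditional stability), $$\|y^{p+1}\|_{2}\le \|y^{0}\|_{0}+\beta\sum_{j=1}^{p+1}\|u^{j}\|_{0},\qquad p=0,1,\dots,K-1.$$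
   Context: This is the time-semidiscretization (L1 / backward Euler approximation of the Caputo derivative) of the fourth-order time-fractional equation $\partial_t^\gamma y+\alpha\,\partial_x^4 y=u(x,t)$ on $[0,L]\times[0,T]$. Here $\langle f,g\rangle=\int_0^L fg\,dx$ and $\|g\|_0=\langle g,g\rangle^{1/2}$ is the $L^2(0,L)$ norm. $H^2(0,L)=\{g\in L^2(0,L): g_x,g_{xx}\in L^2(0,L)\}$ and $H_0^2(0,L)=\{g\in H^2(0,L): g=0 \text{ and } g_x=0 \text{ at } x=0,L\}$. The norm $\|\cdot\|_2$ is defined by $\|g\|_2=\big(\|g\|_0^2+\beta\alpha\|g_{xx}\|_0^2\big)^{1/2}$. An empty sum (when $p=1$) is zero. *)

(* Defs.v *)
From HB Require Import structures.
From mathcomp Require Import all_boot all_order all_algebra.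
From mathcomp Require Import all_classical all_reals all_analysis.
Import numFieldNormedType.Exports.
Set Implicit Arguments. Unset Strict Implicit. Unset Printing Implicit Defensive.
Import Order.TTheory GRing.Theory Num.Theory.
Local Open Scope classical_set_scope.
Local Open Scope ring_scope.

Section Defs.
Variable R : realType.
Local Notation mu := (@lebesgue_measure R).

Definition I0L (L : R) : set R := `[0, L]%classic.

Definition Gamma (s : R) : R :=
  Rintegral mu `]0, +oo[%classic (fun t => powR t (s - 1) * expR (- t)).

Definition L2 (L : R) (g : R -> R) : Prop :=
  measurable_fun (I0L L) g /\ mu.-integrable (I0L L) (fun x => ((g x) ^+ 2)%:E).

Definition inner (L : R) (f g : R -> R) : R :=
  Rintegral mu (I0L L) (fun x => f x * g x).

Definition norm0 (L : R) (g : R -> R) : R := Num.sqrt (inner L g g).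

Definition norm2 (L beta alpha : R) (g gxx : R -> R) : R :=
  Num.sqrt (norm0 L g ^+ 2 + beta * alpha * norm0 L gxx ^+ 2).

Definition test_fun (L : R) (phi : R -> R) : Prop :=
  (forall n x, derivable (derive1n n phi) x 1) /\
  exists a b : R, 0 < a /\ b < L /\ forall x, (x < a \/ b < x) -> phi x = 0.

Definition weak_deriv (L : R) (f h : R -> R) : Prop :=
  forall phi, test_fun L phi ->
    Rintegral mu (I0L L) (fun x => f x * derive1 phi x)
    = - Rintegral mu (I0L L) (fun x => h x * phi x).

Definition weak_deriv2 (L : R) (f h : R -> R) : Prop :=
  forall phi, test_fun L phi ->
    Rintegral mu (I0L L) (fun x => f x * derive1n 2 phi x)
    = Rintegral mu (I0L L) (fun x => h x * phi x).

(* g vanishes at x = 0 and x = L, in the sense of its continuous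
   representative on [0,L] (the trace) *)
Definition vanishes_at_ends (L : R) (g : R -> R) : Prop :=
  exists c : R -> R, {within (I0L L), continuous c} /\
    {ae mu, forall x, (I0L L) x -> g x = c x} /\ c 0 = 0 /\ c L = 0.

Definition H02_with (L : R) (g gx gxx : R -> R) : Prop :=
  L2 L g /\ L2 L gx /\ L2 L gxx /\ weak_deriv L g gx /\ weak_deriv L gx gxx
  /\ vanishes_at_ends L g /\ vanishes_at_ends L gx.

Definition H02 (L : R) (g : R -> R) : Prop :=
  exists gx gxx, H02_with L g gx gxx.

Definition bcoef (gamma : R) (j : nat) : R :=
  powR (j.+1)%:R (1 - gamma) - powR j%:R (1 - gamma).

End Defs.

(* Main.v *)
(* Testing the scheme at step p + 1 with g = y^(p+1) and integrating by parts
   twice, the left-hand side becomes the square of the 2-norm of y^(p+1).  By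
   concavity of x^(1-gamma) the weights 1 - b_1, b_j - b_(j+1), b_p are
   nonnegative, and they telescope to 1; so by Cauchy-Schwarz and strong
   induction the right-hand side is at most (M_p + beta |u^(p+1)|_0) |y^(p+1)|_0,
   where M_p is the claimed bound at the previous step, and one factor
   |y^(p+1)|_0 <= |y^(p+1)|_2 cancels.

   The integration by parts <w'', g> = <w, g''> holds for g in H_0^2 and w, w''
   in L^2.  By du Bois-Reymond's lemma the boundary conditions make g the double
   primitive of g'' from 0, with g and g' vanishing at L, whereas w is the double
   primitive of w'' up to an affine function; affine functions are orthogonal to
   g'', and the primitives are handled by Fubini.  The fundamental lemma behind
   this uses test functions built from exp(-1/x) that converge boundedly to the
   indicator of ]0, x[, and Lebesgue's differentiation theorem. *)

Require Import Defs.
From HB Require Import structures.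
From mathcomp Require Import all_boot all_order all_algebra.
From mathcomp Require Import all_classical all_reals all_analysis.
From mathcomp Require Import measurable_realfun zify ring lra.
Import Order.TTheory GRing.Theory Num.Theory.
Local Open Scope ring_scope.

Section Sobolev.
Set Implicit Arguments. Unset Strict Implicit.
Import numFieldNormedType.Exports.
Local Open Scope classical_set_scope.
Context {R : realType}.
Implicit Types (L c : R) (f g h w phi psi : R -> R).
Local Notation mu := (@lebesgue_measure R).

(** * Integrals and primitives on [0, L] *)

Definition integ L f := mu.-integrable (I0L L) (EFin \o f).
Definition integral0L L f := Rintegral mu (I0L L) f.
(** Total on the real line: for x < 0 the interval is empty and the value is 0. *)
Definition prim f x : R := Rintegral mu (I0L x) f.

Lemma measurable_I0L L : measurable (I0L L).
Proof. exact: measurable_itv. Qed.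

(* [lebesgue_measure] is attached to a sigma-algebra on [R] whose display differs
   from the default one, hence two versions of the same fact. *)
Lemma lebesgue_measurable_I0L L : @measurable _ (measurableTypeR R) (I0L L).
Proof. exact: measurable_itv. Qed.
Hint Resolve measurable_I0L lebesgue_measurable_I0L : core.

Lemma integ_measurable L f : integ L f -> measurable_fun (I0L L) f.
Proof. by move=> /measurable_int/measurable_EFinP. Qed.

Lemma EFin_Rintegral (D : set (measurableTypeR R)) f :
  measurable D -> mu.-integrable D (EFin \o f) ->
  (\int[mu]_(x in D) (f x)%:E)%E = (Rintegral mu D f)%:E.
Proof. by move=> mD hf; rewrite /Rintegral fineK//; exact: integrable_fin_num. Qed.

Lemma integ_lin L f g c : integ L f -> integ L g ->
  integ L (fun x => f x + c * g x).
Proof.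
move=> hf hg; have mL := lebesgue_measurable_I0L L.
exact: (integrableD mL hf (integrableZl mL c hg)).
Qed.

Lemma integ_mulr_bounded L f g : integ L f -> measurable_fun (I0L L) g ->
  [bounded g x | x in I0L L] -> integ L (fun x => f x * g x).
Proof. by move=> hf mg bg; exact: (integrableMl _ hf mg bg). Qed.

Lemma integ_continuous L f : {within I0L L, continuous f} -> integ L f.
Proof. by move=> cf; apply: continuous_compact_integrable => //; exact: segment_compact. Qed.

Lemma within_continuous_bounded L f : {within I0L L, continuous f} ->
  measurable_fun (I0L L) f /\ [bounded f x | x in I0L L].
Proof.
move=> cf; split; first exact: subspace_continuous_measurable_fun.
have /compact_bounded[M [Mr Mf]] := continuous_compact cf (@segment_compact R 0 L).
by exists M; split=> // ? ? ? ?; exact: Mf.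
Qed.

Lemma integ_mulr L f g : integ L f -> {within I0L L, continuous g} ->
  integ L (fun x => f x * g x).
Proof. by move=> hf /within_continuous_bounded[]; exact: integ_mulr_bounded. Qed.

Lemma continuous_prim L f : 0 <= L -> integ L f ->
  {within I0L L, continuous (prim f)}.
Proof. exact: parameterized_integral_continuous. Qed.

Lemma integral0L_lin L f g c : integ L f -> integ L g ->
  integral0L L (fun x => f x + c * g x) = integral0L L f + c * integral0L L g.
Proof.
move=> hf hg; rewrite /integral0L RintegralD//; last exact: integrableZl hg.
by rewrite RintegralZl.
Qed.

Lemma eq_integral0L L f g : {in I0L L, f =1 g} ->
  integral0L L f = integral0L L g.
Proof. by move=> fg; apply: eq_Rintegral => x; rewrite inE => /mem_set /fg. Qed.

Lemma ae_eq_integral0L L f g : integ L f -> integ L g ->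
  {ae mu, forall x, I0L L x -> f x = g x} -> integral0L L f = integral0L L g.
Proof.
move=> hf hg fg; rewrite /integral0L /Rintegral; congr fine.
apply: ae_eq_integral => //; [exact: (measurable_int mu hf)|
  exact: (measurable_int mu hg)|].
apply: (@filterS _ _ (ae_filter_ringOfSetsType mu) _ _ _ fg).
by move=> x /= {}fg xI; rewrite fg.
Qed.

Lemma integ_restrict L f : integ L f <->
  mu.-integrable setT (EFin \o (f \_ (I0L L))).
Proof. by rewrite /integ -restrict_EFin; exact: integrable_mkcond. Qed.

Lemma integ_sub L c f : c <= L -> integ L f -> integ c f.
Proof.
move=> cL; apply: integrableS => //.
by apply: subset_itvl; rewrite bnd_simp.
Qed.

(* Integration by parts for absolutely continuous functions, by Fubini on the
   triangle [t <= x]. *)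
Lemma integral0L_prim L f g : 0 <= L -> integ L f -> integ L g ->
  integral0L L (fun x => prim f x * g x) =
  prim f L * prim g L - integral0L L (fun x => f x * prim g x).
Proof.
move=> L0 hf hg.
(* Extension by zero turns both iterated integrals into integrals over the whole line, so that the
   triangle is carried by the indicator of [A] alone. *)
pose f' := f \_ (I0L L); pose g' := g \_ (I0L L).
pose A := [set z : R * R | z.2 <= z.1].
have mA : measurable A.
  have := @measurable_fun_ler _ _ _ setT _ _
    (@measurable_snd _ _ R R) (@measurable_fst _ _ R R).
  by move=> /(_ measurableT [set true] I); rewrite setTI; congr measurable.
have AE x t : ((x, t) \in A) = (t <= x).
  by apply/idP/idP => [/set_mem//|h]; apply/mem_set.
have hf' : mu.-integrable setT (EFin \o f') by exact/integ_restrict.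
have hg' : mu.-integrable setT (EFin \o g') by exact/integ_restrict.
have mf' : measurable_fun setT f' by case/integrableP : hf' => /measurable_EFinP.
have mg' : measurable_fun setT g' by case/integrableP : hg' => /measurable_EFinP.
pose H (z : R * R) := (g' z.1 * (f' z.2 * \1_A z))%:E.
have mH : measurable_fun setT H.
  apply/measurable_EFinP; apply: measurable_funM.
    exact: measurableT_comp.
  apply: measurable_funM; first exact: measurableT_comp.
  exact: measurable_indic.
(* By Tonelli it suffices that the iterated integral of |H| is finite, and |H| is at most |g'(x)|
   |f'(t)|, whose integral is a product of two finite numbers. *)
have iH : (mu \x mu)%E.-integrable setT H.
  apply/integrable12ltyP => //.
  have nf : (\int[mu]_t `|(f' t)%:E| < +oo)%E by case/integrableP : hf'.
  have ng : (\int[mu]_t `|(g' t)%:E| < +oo)%E by case/integrableP : hg'.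
  apply: (@le_lt_trans _ _
    (\int[mu]_x (`|(g' x)%:E| * \int[mu]_t `|(f' t)%:E|))%E).
    apply: ge0_le_integral => //.
    - by move=> x _; exact: integral_ge0.
    - apply: (@measurable_fun_fubini_tonelli_F _ _ _ _ _ mu (abse \o H)).
        exact: measurableT_comp.
      by move=> x; exact: abse_ge0.
    - apply: emeasurable_funM => //.
      by apply: measurableT_comp => //; exact/measurable_EFinP.
    move=> x _; rewrite -ge0_integralZl//; last first.
      by apply: measurableT_comp => //; exact/measurable_EFinP.
    apply: ge0_le_integral => //.
    - apply: measurableT_comp => //; apply: measurableT_comp mH _.
      exact: measurable_pair1.
    - apply: emeasurable_funM => //.
      by apply: measurableT_comp => //; exact/measurable_EFinP.
    move=> t _; rewrite /H/= lee_fin !normrM ler_wpM2l// ler_piMr//.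
    by rewrite indicE normr_nat lern1 leq_b1.
  rewrite ge0_integralZr//; last 2 first.
    by apply: measurableT_comp => //; exact/measurable_EFinP.
    exact: integral_ge0.
  by rewrite lte_mul_pinfty// ?ge0_fin_numE//; exact: integral_ge0.
have LHS x : (\int[mu]_t H (x, t) = (((fun x => prim f x * g x) \_ (I0L L)) x)%:E)%E.
  rewrite /H/= /g' !patchE; case: ifPn => xI; last first.
    by under eq_integral do rewrite mul0r; rewrite integral0.
  have xL : x <= L by move: xI; rewrite inE /I0L /= in_itv/= => /andP[].
  have hfx := (integ_restrict x f).1 (integ_sub xL hf).
  under eq_integral => t _.
    rewrite (_ : f' t * \1_A (x, t) = (f \_ (I0L x)) t); last first.
      rewrite /f' indicE AE !patchE /I0L !mem_setE !in_itv/=.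
      case: (leP t x) => tx; rewrite ?mulr0 ?mulr1 ?andbF ?andbT//.
      by rewrite (le_trans tx xL) andbT.
    rewrite EFinM; over.
  rewrite integralZl// (EFin_Rintegral _ hfx)// -EFinM mulrC; congr (_ * _)%:E.
  by rewrite -Rintegral_mkcond.
(* For fixed t the triangle leaves x in [t, L], over which g has integral [prim g L - prim g t]. *)
have RHS t : (\int[mu]_x H (x, t) =
   (((fun t => prim g L * f t + (-1) * (f t * prim g t)) \_ (I0L L)) t)%:E)%E.
  rewrite /H/= /f' !patchE; case: ifPn => tI; last first.
    by under eq_integral do rewrite mul0r mulr0; rewrite integral0.
  move: tI; rewrite inE /I0L /= in_itv/= => /andP[t0 tL].
  have hgt : mu.-integrable `[t, L] (EFin \o g).
    by apply: integrableS hg => //; apply: subset_itvr; rewrite bnd_simp.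
  have hgt' : mu.-integrable setT (EFin \o (g \_ `[t, L])).
    by rewrite -restrict_EFin; exact: (integrable_mkcond _ _).1 hgt.
  under eq_integral => x _.
    rewrite (_ : g' x * (f t * \1_A (x, t)) = f t * (g \_ `[t, L]) x); last first.
      rewrite mulrCA; congr (_ * _).
      rewrite /g' indicE AE !patchE /I0L !mem_setE !in_itv/=.
      case: (leP t x) => tx; rewrite ?mulr0 ?mulr1//.
      by rewrite (le_trans t0 tx).
    rewrite EFinM; over.
  rewrite integralZl// (EFin_Rintegral _ hgt')// -EFinM -Rintegral_mkcond.
  congr (_%:E); rewrite -Rintegral_itv_obnd_cbnd; last first.
    by apply: integrableS hgt => //; apply: subset_itvr; rewrite bnd_simp.
  rewrite -(@Rintegral_itvB _ _ (BLeft 0) (BRight L))//.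
  by rewrite /prim /I0L; ring.
have ifp : integ L (fun x => f x * prim g x).
  exact: integ_mulr (continuous_prim L0 hg).
have := Fubini iH.
under eq_integral do rewrite LHS.
under [in X in _ = X -> _]eq_integral do rewrite RHS.
move=> /(congr1 fine).
rewrite -![fine _]/(Rintegral _ _ _) -!Rintegral_mkcond.
move=> E.
transitivity (integral0L L (fun x => prim g L * f x + (-1) * (f x * prim g x))).
  exact: E.
rewrite integral0L_lin//; last first.
  by rewrite /integ; apply: integrableZl hf.
by rewrite /integral0L RintegralZl// -/(prim f L); ring.
Qed.

(** * Smooth functions *)

Definition smooth f := forall n x, derivable (derive1n n f) x 1.

(** All derivatives stay in the class [P], so smoothness follows without any formula for the n-th
    derivative. *)
Lemma smooth_coind (P : (R -> R) -> Prop) :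
  (forall f, P f -> (forall x, derivable f x 1) /\ P (f^`())) ->
  forall f, P f -> smooth f.
Proof.
move=> Pd f Pf n; elim: n f Pf => [|n IH] f /Pd[df Pf']; first exact: df.
by move=> x; rewrite /derive1n iterSr; exact: IH.
Qed.

Lemma smooth_derivable f (x : R) : smooth f -> is_derive x 1 f (f^`() x).
Proof. by move=> sf; rewrite derive1E; apply: derivableP; exact: (sf 0%N). Qed.

Lemma smooth_derive1 f : smooth f -> smooth (f^`()).
Proof. by move=> sf n x; have := sf n.+1 x; rewrite /derive1n iterSr. Qed.

Lemma smooth_is_derive f h : (forall x : R, is_derive x 1 f (h x)) -> smooth h ->
  smooth f.
Proof.
move=> df sh [|n] x; first by case: (df x).
rewrite /derive1n iterSr (_ : f^`() = h); first exact: sh.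
by apply/funext => z; rewrite derive1E derive_val.
Qed.

(** An inductive class stable under differentiation, made to serve as the invariant of
    [smooth_coind]: sums, products and affine changes of variable are then treated at once. *)
Inductive smooth_closure : (R -> R) -> Prop :=
| smooth_closure_base f : smooth f -> smooth_closure f
| smooth_closure_lin f g c : smooth_closure f -> smooth_closure g ->
    smooth_closure (fun x => f x + c * g x)
| smooth_closure_mul f g : smooth_closure f -> smooth_closure g ->
    smooth_closure (fun x => f x * g x)
| smooth_closure_affine f a b : smooth_closure f ->
    smooth_closure (fun x => f (a * x + b)).

Lemma smooth_closure_smooth f : smooth_closure f -> smooth f.
Proof.
apply: (smooth_coind (P := smooth_closure)) => {}f sf.
suff [f' sf' df] : exists2 f', smooth_closure f' & forall x : R, is_derive x 1 f (f' x).
  split; first by move=> x; case: (df x).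
  rewrite (_ : f^`() = f')//.
  by apply/funext => z; rewrite derive1E; case: (df z).
elim: sf => {f}.
- move=> f sf; exists (f^`()); first exact/smooth_closure_base/smooth_derive1.
  by move=> x; exact: smooth_derivable.
- move=> f g c _ [f' sf' df] _ [g' sg' dg].
  exists (fun x => f' x + c * g' x); first exact: smooth_closure_lin.
  move=> x; have := df x; have := dg x => ? ?.
  exact: is_deriveD (is_deriveZ _ _).
- move=> f g sf [f' sf' df] sg [g' sg' dg].
  exists (fun x => (f' x * g x) + 1 * (f x * g' x)).
    by apply: smooth_closure_lin; exact: smooth_closure_mul.
  move=> x; have dfx := df x; have dgx := dg x.
  apply: (is_derive_eq (is_deriveM dfx dgx)).
  by rewrite /GRing.scale/=; ring.
- move=> f a b sf [f' sf' df].
  (* The factor a of the chain rule is split as 1 + (a - 1) to fit the shape f + c g of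
     [smooth_closure_lin]. *)
  exists (fun x => f' (a * x + b) + (a - 1) * f' (a * x + b)).
    by apply: smooth_closure_lin; exact: smooth_closure_affine.
  move=> x; have dax : is_derive x 1 (fun x : R => a * x + b) a.
    apply: (is_derive_eq (is_deriveD (is_deriveZ a (is_derive_id x 1))
      (is_derive_cst b x 1))).
    by rewrite /GRing.scale/=; ring.
  rewrite -[X in is_derive _ _ X _]/(f \o (fun x : R => a * x + b)).
  have h := is_derive1_comp (f := f) (g := fun x : R => a * x + b) (df (a * x + b)) dax. 
  apply: (is_derive_eq h).
  by rewrite /=; ring.
Qed.

(** * The flat functions p(1/x) exp(-1/x) *)

Lemma exprn_le_expR n (t : R) : 0 <= t -> t ^+ n <= n`!%:R * expR t.
Proof.
case: n => [|n] t0; first by rewrite expr0 fact0 mul1r (le_trans _ (expR_ge1Dx t))// lerDl.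
have := expR_ge1Dxn n t0 => h.
rewrite -ler_pdivrMl ?ltr0n ?fact_gt0// mulrC.
by apply: le_trans h; rewrite lerDr.
Qed.

Lemma horner_le_expR (q : {poly R}) :
  exists C : R, 0 <= C /\ forall t, 0 <= t -> `|q.[t]| <= C * expR t.
Proof.
exists (\sum_(i < size q) `|q`_i| * i`!%:R); split.
  by apply: sumr_ge0 => i _; rewrite mulr_ge0.
move=> t t0; rewrite horner_coef mulr_suml.
apply: le_trans (ler_norm_sum _ _ _) _; apply: ler_sum => i _.
rewrite normrM -mulrA ler_wpM2l// ger0_norm ?exprn_ge0//.
exact: exprn_le_expR.
Qed.

(* Smooth at the origin: the family is closed under differentiation, with
   [flat p] differentiating to [flat (X^2 (p - p'))]. *)
Definition flat (p : {poly R}) (x : R) : R :=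
  if 0 < x then p.[x^-1] * expR (- x^-1) else 0.

(** The exponential bound for X^2 p, taken at 1/x, absorbs exp(-1/x) and leaves a factor x^2. This
    quadratic bound is what forces a zero derivative at the origin. *)
Lemma flat_le_sqr (p : {poly R}) :
  exists C : R, 0 <= C /\ forall x, `|flat p x| <= C * x ^+ 2.
Proof.
have [C [C0 hC]] := horner_le_expR ('X^2 * p).
exists C; split=> // x; rewrite /flat; case: ifPn => x0; last first.
  by rewrite normr0 mulr_ge0// sqr_ge0.
have /hC : 0 <= x^-1 by rewrite invr_ge0 ltW.
rewrite hornerM hornerXn [`|_ ^+ 2 * _|]normrM (ger0_norm (sqr_ge0 _)).
rewrite [`|_ * expR _|]normrM (ger0_norm (expR_ge0 _)).
rewrite expRN ler_pdivrMr ?expR_gt0// exprVn mulrC.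
by rewrite ler_pdivrMr ?exprn_gt0// mulrAC.
Qed.

Lemma is_derive_flat (p : {poly R}) (x : R) :
  is_derive x 1 (flat p) (flat ('X^2 * (p - p^`())) x).
Proof.
have [x0|x0|->] := ltrgtP x 0.
- rewrite {2}/flat ltNge ltW//=.
  apply: (@near_eq_is_derive _ _ _ (cst 0)).
  near=> y; rewrite /flat ltNge ltW//=; near: y.
  exact: lt_nbhsl.
- rewrite {2}/flat x0.
  apply: (@near_eq_is_derive _ _ _ (fun y : R => p.[y^-1] * expR (- y^-1))).
    near=> y; rewrite /flat ifT//; near: y.
    exact: lt_nbhsr.
  have xn0 : x != 0 by rewrite gt_eqF.
  have dV : is_derive x 1 (fun y : R => y^-1) (- x ^- 2).
    apply: (is_derive_eq (is_deriveV xn0 (is_derive_id x 1))).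
    by rewrite /GRing.scale/= mulr1.
  have dp : is_derive x 1 (fun y : R => p.[y^-1]) (p^`().[x^-1] * - x ^- 2).
    exact: (is_derive1_comp (f := horner p) (g := fun y : R => y^-1) _ dV).
  have dN : is_derive x 1 (fun y : R => - y^-1) (- - x ^- 2).
    exact: is_deriveN dV.
  have de : is_derive x 1 (fun y : R => expR (- y^-1)) (expR (- x^-1) * - - x ^- 2).
    exact: (is_derive1_comp (f := expR) (g := fun y : R => - y^-1) _ dN).
  apply: (is_derive_eq (is_deriveM dp de)).
  by rewrite /GRing.scale/= hornerM hornerXn hornerD hornerN -exprVn; ring.
- have [C [C0 hC]] := flat_le_sqr p.
  have flat0 q : flat q 0 = 0 by rewrite /flat ltxx.
  rewrite flat0.
  have h : (fun h : R => h^-1 *: ((flat p \o shift 0) (h *: 1) - flat p 0)) @ 0^' --> (0 : R).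
    apply/cvgr0Pnorm_le => e e0; near=> t.
    have tn0 : t != 0 by near: t; exact: nbhs_dnbhs_neq.
    rewrite /= addr0 flat0 subr0 [t *: 1]mulr1 normrZ normfV ler_pdivrMl ?normr_gt0//.
    apply: le_trans (hC t) _.
    rewrite -real_normK ?num_real// expr2 mulrA mulrC ler_wpM2l//.
    (* The difference quotient is at most C |t|; dividing by C + 1 avoids a division by zero when C
       = 0. *)
    have : `|t| <= e / (C + 1).
      near: t; apply: dnbhs0_le; rewrite divr_gt0// ltr_wpDl//.
    rewrite ler_pdivlMr ?ltr_wpDl// => te.
    by apply: le_trans te; rewrite mulrC ler_wpM2l// lerDl.
  by split; [apply/cvg_ex; exists 0|apply/cvg_lim].
Unshelve. all: by end_near. Qed.

Lemma smooth_flat (p : {poly R}) : smooth (flat p).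
Proof.
apply: (smooth_coind (P := fun f => exists p, f = flat p)); last by exists p.
move=> f [q ->]; split; first by move=> x; case: (is_derive_flat q x).
exists ('X^2 * (q - q^`())); apply/funext => x.
by rewrite derive1E; have dq := is_derive_flat q x; rewrite derive_val.
Qed.

(** * Test functions *)

Lemma smooth_continuous f : smooth f -> continuous f.
Proof.
move=> sf x; apply: differentiable_continuous; apply/derivable1_diffP.
exact: (sf 0%N).
Qed.

Lemma test_fun_continuous L phi : test_fun L phi -> continuous phi.
Proof. by move=> [sphi _]; exact: smooth_continuous. Qed.

Lemma test_fun_within L phi : test_fun L phi ->
  {within I0L L, continuous phi}.
Proof. by move=> /test_fun_continuous cphi; exact: continuous_subspaceT. Qed.

Lemma test_fun0 L phi x : test_fun L phi -> (x <= 0) || (L <= x) -> phi x = 0.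
Proof.
move=> [_ [a [b [a0 [bL phi0]]]]] /orP[x0|xL]; apply: phi0.
  by left; exact: le_lt_trans a0.
by right; exact: lt_le_trans xL.
Qed.

Lemma test_fun_lin L phi psi c : test_fun L phi -> test_fun L psi ->
  test_fun L (fun x => phi x + c * psi x).
Proof.
move=> [sphi [a [b [a0 [bL phi0]]]]] [spsi [a' [b' [a'0 [b'L psi0]]]]]; split.
  by apply: smooth_closure_smooth; apply: smooth_closure_lin; apply: smooth_closure_base.
exists (Num.min a a'), (Num.max b b'); rewrite lt_min a0 a'0 gt_max bL b'L.
do 2!split => //; move=> x; rewrite lt_min gt_max => xab.
rewrite phi0 ?psi0 ?mulr0 ?addr0//; by case: xab => /andP[]; [left|right].
Qed.

Lemma test_fun_derive1 L phi : test_fun L phi -> test_fun L (phi^`()).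
Proof.
move=> [sphi [a [b [a0 [bL phi0]]]]]; split; first exact: smooth_derive1.
exists a, b; do 2!split => //; move=> x xab.
rewrite derive1E (@near_eq_derive _ _ _ _ (cst 0)) ?derive_cst//.
case: xab => xab; near=> y; apply: phi0; [left|right]; near: y.
  exact: lt_nbhsl.
exact: lt_nbhsr.
Unshelve. all: by end_near. Qed.

Lemma prim_derive1 L phi x : test_fun L phi -> 0 <= x -> prim (phi^`()) x = phi x.
Proof.
move=> tphi; rewrite le_eqVlt => /predU1P[<-|x0].
  by rewrite /prim /I0L set_itv1 Rintegral_set1 (test_fun0 tphi) ?lexx.
have cphi := test_fun_continuous tphi.
rewrite /prim /I0L /Rintegral (continuous_FTC2 (F := phi))//=.
- by rewrite (test_fun0 (x := 0) tphi) ?lexx// subr0.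
- exact/continuous_subspaceT/test_fun_continuous/test_fun_derive1/tphi.
- split; first by move=> z _; exact: (tphi.1 0%N).
  + by apply: cvg_at_right_filter; exact: cphi.
  + by apply: cvg_at_left_filter; exact: cphi.
Qed.

(** The primitive vanishes before the support of psi, and after it equals the full integral, which
    is 0. Hence every test function of mean zero is the derivative of a test function. *)
Lemma test_fun_prim L psi : 0 < L -> test_fun L psi -> integral0L L psi = 0 ->
  test_fun L (prim psi) /\ (prim psi)^`() = psi.
Proof.
move=> L0 tpsi Jpsi; have [spsi [a [b [a0 [bL psi0]]]]] := tpsi.
have prim0 y : y < a -> prim psi y = 0.
  move=> ya; rewrite /prim /Rintegral integral0_eq// => t.
  rewrite /I0L /= in_itv/= => /andP[_ ty]; rewrite psi0//.
  by left; exact: le_lt_trans ya.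
have dprim (x : R) : is_derive x 1 (prim psi) (psi x).
  (* The fundamental theorem with base point 0 needs x > 0; left of a, which is positive, the
     primitive is locally zero. *)
  have [xa|ax] := ltP x a.
    rewrite psi0; last by left.
    apply: (@near_eq_is_derive _ _ _ (cst 0)).
    by near=> y; rewrite /= prim0//; near: y; exact: lt_nbhsl.
  have xx1 : x < x + 1 by rewrite ltrDl.
  have [] := @continuous_FTC1_closed R psi 0 x (x + 1) xx1.
  - apply: integ_continuous; apply: continuous_subspaceT.
    exact: test_fun_continuous tpsi.
  - exact: lt_le_trans ax.
  - exact: test_fun_continuous tpsi x.
  by move=> d1 d2; apply: DeriveDef; [exact: d1|rewrite -derive1E; exact: d2].
split; last first.
  by apply/funext => x; rewrite derive1E; case: (dprim x).
split; first exact: smooth_is_derive dprim spsi.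
exists a, b; do 2!split => //; move=> y [/prim0//|yb].
rewrite -Jpsi /prim /integral0L Rintegral_mkcond [RHS]Rintegral_mkcond.
congr Rintegral; apply/funext => t; rewrite !patchE /I0L !mem_setE !in_itv/=.
have [tb|bt] := leP t b; last by rewrite psi0 ?if_same//; right.
by rewrite (le_trans tb (ltW yb)) (le_trans tb (ltW bL)).
Unshelve. all: by end_near. Qed.

Lemma flat1_ge0_le1 (x : R) : 0 <= flat 1 x <= 1.
Proof.
rewrite /flat; case: ifPn => x0; last by rewrite lexx ler01.
by rewrite hornerE mul1r expR_ge0 expR_le1 oppr_le0 invr_ge0 ltW.
Qed.

(* Test functions converging pointwise to the indicator of ]0, x[. *)
Definition bump (x : R) (n : nat) (t : R) : R :=
  flat 1 (n.+1%:R * t - 1) * flat 1 (n.+1%:R * (x - t) - 1).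

Lemma test_fun_bump L x n : x <= L -> test_fun L (bump x n).
Proof.
move=> xL; split.
  apply/smooth_closure_smooth/smooth_closure_mul.
    by apply/(smooth_closure_affine n.+1%:R (-1))/smooth_closure_base/smooth_flat.
  rewrite (_ : (fun t => _) = fun t => flat 1 ((- n.+1%:R) * t + (n.+1%:R * x - 1))).
    by apply/smooth_closure_affine/smooth_closure_base/smooth_flat.
  by apply/funext => t; congr flat; ring.
have n0 : 0 < n.+1%:R^-1 :> R by rewrite invr_gt0.
(* [flat 1] vanishes at nonpositive arguments, so the first factor is 0 for t <= 1/(n+1) and the
   second for t >= x - 1/(n+1). *)
exists n.+1%:R^-1, (x - n.+1%:R^-1); split=> //; split.
  by apply: lt_le_trans xL; rewrite ltrBlDr ltrDl.
move=> t [tn|tn]; rewrite /bump /flat ltNge.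
  by rewrite ifF ?mul0r//; apply/negbF; rewrite subr_le0 -ler_pdivlMl// mulr1 ltW.
rewrite [X in _ * (if X then _ else _)]ltNge.
rewrite [X in _ * (if X then _ else _)](_ : _ = false) ?mulr0//.
by apply/negbF; rewrite subr_le0 -ler_pdivlMl// mulr1 lerBlDr addrC -lerBlDr ltW.
Qed.

Lemma cvg_flat1 a b : 0 < a -> flat 1 (n.+1%:R * a + b) @[n --> \oo] --> (1 : R).
Proof.
move=> a0; pose u n : R := n.+1%:R * a + b.
have u_gt A : \forall n \near \oo, A < u n.
  near=> n; rewrite /u -ltrBlDr -ltr_pdivrMr//.
  apply: (@lt_trans _ _ n%:R); last by rewrite ltr_nat.
  by near: n; exact: nbhs_infty_gtr.
have cu : (u n)^-1 @[n --> \oo] --> (0 : R).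
  by apply/gtr0_cvgV0; [exact: u_gt|apply/cvgryPgt].
have cexp : expR (- (u n)^-1) @[n --> \oo] --> (1 : R).
  rewrite -(expR0 R) -[0 in X in _ --> X]oppr0.
  apply: (continuous_cvg (h := fun x => expR (- x)) _ _ cu).
  by apply: continuous_comp; [exact: opp_continuous|exact: continuous_expR].
apply: cvg_trans cexp; apply: near_eq_cvg; near=> n.
by rewrite /flat ifT ?hornerE ?mul1r//; near: n; exact: u_gt.
Unshelve. all: by end_near. Qed.

Lemma cvg_bump x t : bump x n t @[n --> \oo] --> (\1_(`]0, x[) t : R).
Proof.
rewrite indicE mem_setE in_itv/=.
have flat_le0 n y : y <= 0 -> flat 1 (n.+1%:R * y - 1) = 0.
  move=> y0; rewrite /flat ifF//; apply/negbTE; rewrite -leNgt subr_le0.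
  by rewrite (le_trans _ ler01)// mulr_ge0_le0.
have [t0|t0] := leP t 0.
  rewrite (_ : (fun _ => _) = cst 0); first exact: cvg_cst.
  by apply/funext => n; rewrite /bump flat_le0// mul0r.
have [xt|tx] := leP x t.
  rewrite (_ : (fun _ => _) = cst 0); first exact: cvg_cst.
  by apply/funext => n; rewrite /bump [X in _ * X]flat_le0 ?mulr0// subr_le0.
rewrite -[X in _ --> X](mulr1 (1 : R)).
by apply: cvgM; apply: cvg_flat1; rewrite ?subr_gt0.
Qed.

(** * The fundamental lemma of the calculus of variations *)

Lemma ae_filterS (P Q : set R) :
  P `<=` Q -> {ae mu, forall x, P x} -> {ae mu, forall x, Q x}.
Proof. exact: (@filterS _ _ (ae_filter_ringOfSetsType mu)). Qed.

Lemma ae_filterI (P Q : set R) : {ae mu, forall x, P x} ->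
  {ae mu, forall x, Q x} -> {ae mu, forall x, P x /\ Q x}.
Proof. exact: (@filterI _ _ (ae_filter_ringOfSetsType mu)). Qed.

Lemma ae_neq (a : R) : {ae mu, forall x, x <> a}.
Proof.
exists [set a]; split; [exact: measurable_set1|exact: lebesgue_measure_set1|].
by move=> x /= /contrapT.
Qed.

Lemma bump_ge0_le1 (x : R) n (t : R) : 0 <= bump x n t <= 1.
Proof.
have /andP[a0 a1] := flat1_ge0_le1 (n.+1%:R * t - 1).
have /andP[b0 b1] := flat1_ge0_le1 (n.+1%:R * (x - t) - 1).
by rewrite /bump mulr_ge0//= mulr_ile1.
Qed.

(** Dominated convergence, with |f| as dominating function, passes from [bump x n] to the indicator
    of ]0, x[; the endpoints have measure zero. *)
Lemma prim_eq0 L f x : 0 < x -> x <= L -> integ L f ->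
  (forall psi, test_fun L psi -> integral0L L (fun t => f t * psi t) = 0) ->
  prim f x = 0.
Proof.
move=> x0 xL hf fpsi.
have mf := integ_measurable hf.
have cb n := test_fun_within (test_fun_bump n xL).
have ibump n : integ L (fun t => f t * bump x n t) by exact: integ_mulr.
have mind : measurable_fun (I0L L) (\1_(`]0, x[) : R -> R).
  by apply: measurable_indic; exact: measurable_itv.
have [||||| _ _ hlim] := @dominated_convergence _ _ R mu (I0L L)
  (lebesgue_measurable_I0L L)
  (fun n t => (f t * bump x n t)%:E) (fun t => (f t * \1_(`]0, x[) t)%:E)
  (fun t => `|f t|%:E).
- by move=> n; exact: (measurable_int mu (ibump n)).
- by apply/measurable_EFinP; exact: measurable_funM.
- apply: aeW => t _; apply: cvg_EFin; first exact: nearW.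
  by apply: cvgM; [exact: cvg_cst|exact: cvg_bump].
- exact: integrable_norm hf.
- apply: aeW => t n _; have /andP[b0 b1] := bump_ge0_le1 x n t.
  by rewrite /= lee_fin normrM ler_piMr// ger0_norm.
have : (\int[mu]_(t in I0L L) (f t * \1_(`]0, x[) t)%:E = 0)%E.
  apply/esym; apply: cvg_unique hlim => //.
  rewrite (_ : (fun _ => _) = cst 0%E); first exact: cvg_cst.
  apply/funext => n; rewrite (EFin_Rintegral _ (ibump n))//.
  by have := fpsi _ (test_fun_bump n xL); rewrite /integral0L => ->.
move=> /(congr1 fine) h.
have sub : `]0, x[ `<=` I0L L.
  by move=> t; rewrite /I0L /= !in_itv/= => /andP[t0 tx]; rewrite !ltW//= (lt_le_trans tx).
have hf0x : mu.-integrable `]0, x] (EFin \o f).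
  apply: integrableS hf => // t; rewrite /I0L /= !in_itv/= => /andP[t0 tx].
  by rewrite ltW//= (le_trans tx).
rewrite /prim /I0L -Rintegral_itv_obnd_cbnd// -Rintegral_itv_bndo_bndc; last first.
  by apply: integrableS hf0x => //; apply: subset_itvl; rewrite bnd_simp.
rewrite -(setIidr sub) Rintegral_mkcondr -[RHS]h /Rintegral; congr fine.
apply: eq_integral => t _; rewrite patchE indicE.
by case: ifPn => _; rewrite ?mulr1 ?mulr0.
Qed.

(** The primitive of f vanishes on ]0, L[, so its derivative is 0 there; by Lebesgue differentiation
    this derivative is f almost everywhere. *)
Lemma ae_eq0_test_fun L f : 0 < L -> integ L f ->
  (forall psi, test_fun L psi -> integral0L L (fun t => f t * psi t) = 0) ->
  {ae mu, forall x, I0L L x -> f x = 0}.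
Proof.
move=> L0 hf fpsi; pose f' := f \_ (I0L L).
have hf' : mu.-integrable setT (EFin \o f') by exact/integ_restrict.
have hf'S (D : set (measurableTypeR R)) : measurable D -> mu.-integrable D (EFin \o f').
  by move=> mD; apply: integrableS hf'.
have := @FTC1 R f' (BLeft 0) (fun y => hf'S _ (measurable_itv _))
  (integrable_locally (measurable_I0L L) hf).
(* The endpoints are discarded so that a whole neighbourhood of x lies in ]0, L[. *)
move=> /ae_filterI/(_ (ae_filterI (ae_neq 0) (ae_neq L))).
apply: ae_filterS => x [FTC [/eqP x0 /eqP xL]].
rewrite /I0L /= in_itv/= => /andP[x_ge0 x_leL].
have {}x0 : 0 < x by rewrite lt_def x0.
have {}xL : x < L by rewrite lt_def eq_sym xL.
have [|_] := FTC; first by rewrite /= lte_fin.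
rewrite /f' patchE ifT; last by rewrite mem_setE in_itv/= x_ge0.
move=> <-; rewrite derive1E (@near_eq_derive _ _ _ _ (cst 0)) ?derive_cst//.
near=> y.
have y0 : 0 < y by near: y; exact: lt_nbhsr.
have yL : y < L by near: y; exact: lt_nbhsl.
rewrite -[RHS](prim_eq0 y0 (ltW yL) hf fpsi) /prim /I0L.
apply: eq_Rintegral => t; rewrite inE/= in_itv/= => /andP[t0 ty].
by rewrite /f' patchE ifT// mem_setE in_itv/= t0 (le_trans ty)// ltW.
Unshelve. all: by end_near. Qed.

Lemma integ_cst L c : integ L (cst c).
Proof. by apply: integ_continuous; apply: continuous_subspaceT => x; exact: cvg_cst. Qed.

Lemma integ_test_fun L psi : test_fun L psi -> integ L psi.
Proof. by move=> /test_fun_within; exact: integ_continuous. Qed.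

Lemma integ_mul_test_fun L f psi : integ L f -> test_fun L psi ->
  integ L (fun x => f x * psi x).
Proof. by move=> hf /test_fun_within; exact: integ_mulr. Qed.

Lemma integral0L_lin_test L f g psi c : integ L f -> integ L g -> test_fun L psi ->
  integral0L L (fun x => (f x + c * g x) * psi x) =
  integral0L L (fun x => f x * psi x) + c * integral0L L (fun x => g x * psi x).
Proof.
move=> hf hg tpsi; rewrite -integral0L_lin; try exact: integ_mul_test_fun.
by apply: eq_integral0L => x _; ring.
Qed.

Lemma integral0L_test_lin L f phi psi c : integ L f -> test_fun L phi ->
  test_fun L psi ->
  integral0L L (fun x => f x * (phi x + c * psi x)) =
  integral0L L (fun x => f x * phi x) + c * integral0L L (fun x => f x * psi x).
Proof.
move=> hf tphi tpsi; rewrite -integral0L_lin; try exact: integ_mul_test_fun.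
by apply: eq_integral0L => x _; ring.
Qed.

Lemma negligible_not_itv a b : a < b -> ~ mu.-negligible (`]a, b[ : set R).
Proof.
move=> ab [A [mA A0 sA]].
have : (mu `]a, b[ <= mu A)%E by apply: le_measure => //; rewrite inE.
by rewrite A0 lebesgue_measure_itv/= lte_fin ab -EFinB lee_fin subr_le0 leNgt ab.
Qed.

(* If all test functions had integral 0, the fundamental lemma would give 1 = 0
   almost everywhere. *)
Lemma test_fun_unit_integral L : 0 < L ->
  exists eta, test_fun L eta /\ integral0L L eta = 1.
Proof.
move=> L0; apply: contrapT => no.
have all0 psi : test_fun L psi -> integral0L L (fun t => cst 1 t * psi t) = 0.
  move=> tpsi; apply: contrapT => /eqP J0; apply: no.
  have E : integral0L L (fun t => cst 1 t * psi t) = integral0L L psi.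
    by apply: eq_integral0L => x _; rewrite mul1r.
  rewrite E in J0.
  (* This is psi divided by its integral J, with 1/J written as 1 + (1/J - 1) for [test_fun_lin]. *)
  exists (fun x => psi x + ((integral0L L psi)^-1 - 1) * psi x); split.
    exact: test_fun_lin.
  by rewrite integral0L_lin; [field|exact: integ_test_fun..].
have := ae_eq0_test_fun L0 (integ_cst L 1) all0.
move=> [A [mA A0 sA]]; apply: (negligible_not_itv L0); exists A; split => //.
apply: subset_trans sA => x /=; rewrite /I0L /= !in_itv/= => /andP[x0 xL].
by move=> /(_ _)/eqP; rewrite oner_eq0 !ltW// => /(_ isT).
Qed.

(** Du Bois-Reymond's lemma. Subtracting from psi its integral times eta gives mean zero, hence the
    derivative of a test function; so f - c, with c the integral of f eta, is orthogonal to every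
    psi. *)
Lemma ae_cst_test_fun L f : 0 < L -> integ L f ->
  (forall phi, test_fun L phi -> integral0L L (fun x => f x * derive1 phi x) = 0) ->
  exists c, {ae mu, forall x, I0L L x -> f x = c}.
Proof.
move=> L0 hf fphi; have [eta [teta Jeta]] := test_fun_unit_integral L0.
pose c := integral0L L (fun x => f x * eta x).
exists c; have hc := integ_cst L 1.
suff : {ae mu, forall x, I0L L x -> f x + (- c) * cst 1 x = 0}.
  apply: ae_filterS => x fx /fx/eqP.
  by rewrite mulr1 subr_eq0 => /eqP.
apply: ae_eq0_test_fun => //; first exact: integ_lin.
move=> psi tpsi; rewrite integral0L_lin_test//.
have [||tprim dprim] := test_fun_prim (psi := fun x => psi x + (- integral0L L psi) * eta x) L0.
- exact: test_fun_lin.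
- by rewrite integral0L_lin ?Jeta; [ring|exact: integ_test_fun..].
have := fphi _ tprim; rewrite dprim integral0L_test_lin// -/c.
rewrite (eq_integral0L (f := fun x => cst 1 x * psi x) (g := psi)) => [E|x _];
  last by rewrite /= mul1r.
by rewrite -[RHS]E; ring.
Qed.

(** Integration by parts, whose boundary term dies with phi(L) = 0; thus a primitive has its
    integrand as weak derivative. *)
Lemma integral0L_prim_derive1 L h phi : 0 < L -> integ L h -> test_fun L phi ->
  integral0L L (fun x => prim h x * derive1 phi x) =
  - integral0L L (fun x => h x * phi x).
Proof.
move=> L0 hh tphi; have tphi' := test_fun_derive1 tphi.
rewrite integral0L_prim ?(ltW L0)//; last exact: integ_test_fun.
rewrite (prim_derive1 tphi (ltW L0)) (test_fun0 tphi) ?lexx ?orbT// mulr0 sub0r.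
congr (- _); apply: eq_integral0L => x.
rewrite inE /I0L /= in_itv/= => /andP[x0 _].
by rewrite (prim_derive1 tphi).
Qed.

Lemma prim_cst1 (x : R) : 0 <= x -> prim (cst 1) x = x.
Proof.
move=> x0; rewrite /prim /I0L (@Rintegral_cst _ _ R)//.
rewrite -[X in fine X]/(lebesgue_measure `[0, x]%classic) lebesgue_measure_itv/= lte_fin.
by rewrite lt_def x0 andbT; case: eqVneq => [->|_]; rewrite /= ?mulr0 ?mul1r ?subr0.
Qed.

Lemma integral0L_id_derive1 L phi : 0 < L -> test_fun L phi ->
  integral0L L (fun x => x * derive1 phi x) = - integral0L L phi.
Proof.
move=> L0 tphi.
rewrite -[in RHS](eq_integral0L (f := fun x => cst 1 x * phi x)); last first.
  by move=> x _; rewrite mul1r.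
rewrite -integral0L_prim_derive1//; last exact: integ_cst.
apply: eq_integral0L => x; rewrite inE /I0L /= in_itv/= => /andP[x0 _].
by rewrite prim_cst1.
Qed.

Lemma integ_id L : integ L idfun.
Proof. by apply: integ_continuous; apply: continuous_subspaceT => x; exact: cvg_id. Qed.

Lemma derive1_lin L phi psi c : test_fun L phi -> test_fun L psi ->
  (fun x => phi x + c * psi x)^`() = fun x => derive1 phi x + c * derive1 psi x.
Proof.
move=> [sphi _] [spsi _]; apply/funext => x.
have dphi := smooth_derivable x sphi; have dpsi := smooth_derivable x spsi.
by rewrite derive1E; case: (is_deriveD dphi (is_deriveZ c dpsi)).
Qed.

(** Reduction to the constant case for w + c x, with c the integral of w eta'. If J is the integral
    of phi, then phi - J eta is the derivative of a test function, so w phi' has integral c J, while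
    c x phi' has integral - c J. *)
Lemma ae_affine_test_fun L w : 0 < L -> integ L w ->
  (forall phi, test_fun L phi -> integral0L L (fun x => w x * derive1 (derive1 phi) x) = 0) ->
  exists a b, {ae mu, forall x, I0L L x -> w x = a * x + b}.
Proof.
move=> L0 hw wphi; have [eta [teta Jeta]] := test_fun_unit_integral L0.
have hid := integ_id L.
pose c := integral0L L (fun x => w x * derive1 eta x).
have [|phi tphi|b wb] := ae_cst_test_fun (f := fun x => w x + c * idfun x) L0.
- exact: integ_lin.
- have tphi' := test_fun_derive1 tphi; have teta' := test_fun_derive1 teta.
  rewrite integral0L_lin_test//= integral0L_id_derive1//.
  have [||tprim dprim] := test_fun_prim (psi := fun x => phi x + (- integral0L L phi) * eta x) L0.
  + exact: test_fun_lin.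
  + by rewrite integral0L_lin ?Jeta; [ring|exact: integ_test_fun..].
  have := wphi _ tprim; rewrite dprim (derive1_lin _ tphi teta).
  rewrite integral0L_test_lin// -/c => E.
  by rewrite -[RHS]E; ring.
exists (- c), b; move: wb; apply: ae_filterS => x wx /wx/= <-; ring.
Qed.

(** * Weak derivatives *)

(** The product is dominated by f^2 + g^2. *)
Lemma L2_mul L f g : L2 L f -> L2 L g -> integ L (fun x => f x * g x).
Proof.
move=> [mf hf] [mg hg].
have hs : mu.-integrable (I0L L) (fun x => ((f x) ^+ 2)%:E + ((g x) ^+ 2)%:E)%E.
  exact: (integrableD (lebesgue_measurable_I0L L) hf hg).
apply: le_integrable hs => //.
  by apply/measurable_EFinP; exact: measurable_funM.
move=> x _ /=; rewrite lee_fin normrM [leRHS]ger0_norm ?addr_ge0 ?sqr_ge0//.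
rewrite -(real_normK (num_real (f x))) -(real_normK (num_real (g x))).
have := sqr_ge0 (`|f x| - `|g x|); have := sqr_ge0 (`|f x| + `|g x|); nra.
Qed.

Lemma L2_cst1 L : L2 L (cst 1).
Proof.
split; first exact: measurable_cst.
have := integ_cst L 1; rewrite /integ; congr integrable.
by apply/funext => x /=; rewrite expr1n.
Qed.

Lemma L2_integ L f : L2 L f -> integ L f.
Proof.
move=> /(fun hf => L2_mul hf (L2_cst1 L)); rewrite /integ.
by congr integrable; apply/funext => x /=; rewrite mulr1.
Qed.

(** A nonzero value at x would persist on an interval of positive length. *)
Lemma ae_eq0_continuous L (d : R -> R) x : 0 < L -> {within I0L L, continuous d} ->
  {ae mu, forall t, I0L L t -> d t = 0} -> I0L L x -> d x = 0.
Proof.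
move=> L0 cd d0 xI; apply: contrapT => /eqP dx0.
have /subspace_continuousP/(_ x xI)/cvgrPdist_lt/(_ `|d x|) := cd.
rewrite normr_gt0 dx0 => /(_ isT)/nbhs_ballP[e /= e0 near_x].
move: (xI); rewrite /I0L /= in_itv/= => /andP[x0 xL].
(* Clipping to [0, L] keeps the interval nonempty even when x is an endpoint, because 0 < L. *)
pose a := Num.max 0 (x - e); pose b := Num.min L (x + e).
have ab : a < b.
  by rewrite /a /b gt_max !lt_min; apply/andP; split; apply/andP; split; lra.
apply: (negligible_not_itv ab); case: d0 => A [mA A0 sA]; exists A; split => //.
apply: subset_trans sA => t /=; rewrite in_itv/= /a /b gt_max lt_min.
move=> /andP[/andP[t0 et] /andP[tL te]] dt.
have tI : I0L L t by rewrite /I0L /= in_itv/= !ltW.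
have /near_x/(_ tI) : ball x e t by rewrite /ball/= ltr_distlC; apply/andP; split; lra.
by rewrite [from_subspace _ _ t](dt tI) subr0 ltxx.
Qed.

Lemma weak_deriv_prim L f h : 0 < L -> integ L f -> integ L h -> weak_deriv L f h ->
  exists c, {ae mu, forall x, I0L L x -> f x = prim h x + c}.
Proof.
move=> L0 hf hh fh.
have hprim : integ L (prim h) by apply/integ_continuous/continuous_prim => //; exact: ltW.
have [||c fc] := ae_cst_test_fun (f := fun x => f x + (-1) * prim h x) L0.
- exact: integ_lin.
- move=> phi tphi; have tphi' := test_fun_derive1 tphi.
  rewrite integral0L_lin_test// integral0L_prim_derive1//.
  have := fh _ tphi; rewrite -![Rintegral _ _ _]/(integral0L _ _) => ->; ring.
exists c; move: fc; apply: ae_filterS => x fx /fx <-; ring.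
Qed.

Lemma weak_deriv2_prim L w h : 0 < L -> integ L w -> integ L h -> weak_deriv2 L w h ->
  exists a b, {ae mu, forall x, I0L L x -> w x = prim (prim h) x + (a * x + b)}.
Proof.
move=> L0 hw hh wh.
have hprim : integ L (prim h) by apply/integ_continuous/continuous_prim => //; exact: ltW.
have hprim2 : integ L (prim (prim h)) by apply/integ_continuous/continuous_prim => //; exact: ltW.
have [||a [b wab]] := ae_affine_test_fun (w := fun x => w x + (-1) * prim (prim h) x) L0.
- exact: integ_lin.
- move=> phi tphi; have tphi' := test_fun_derive1 tphi.
  have tphi'' := test_fun_derive1 tphi'.
  rewrite integral0L_lin_test// integral0L_prim_derive1// integral0L_prim_derive1//.
  have := wh _ tphi; rewrite -![Rintegral _ _ _]/(integral0L _ _) => ->; ring.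
exists a, b; move: wab; apply: ae_filterS => x wx /wx <-; ring.
Qed.

Lemma prim0 f : prim f 0 = 0.
Proof. by rewrite /prim /I0L set_itv1 Rintegral_set1. Qed.

(** The continuous representative equals [prim h + c] almost everywhere, hence everywhere on [0, L].
    Its value at 0 gives c = 0, and then its value at L gives [prim h L = 0]. *)
Lemma vanishes_at_ends_prim L f h : 0 < L -> integ L f -> integ L h ->
  weak_deriv L f h -> vanishes_at_ends L f ->
  prim h L = 0 /\ {ae mu, forall x, I0L L x -> f x = prim h x}.
Proof.
move=> L0 hf hh fh [d [cd [fd [d0 dL]]]].
have [c fc] := weak_deriv_prim L0 hf hh fh.
have cprim := continuous_prim (ltW L0) hh.
have cdiff : {within I0L L, continuous (fun x => d x - (prim h x + c))}.
  apply/subspace_continuousP => x xI; apply: cvgB.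
    by move/subspace_continuousP : cd; exact.
  by apply: cvgD; [move/subspace_continuousP : cprim; exact|exact: cvg_cst].
have diff0 x : I0L L x -> d x = prim h x + c.
  move=> xI; apply/eqP; rewrite -subr_eq0; apply/eqP.
  apply: (ae_eq0_continuous L0 cdiff) xI.
  move: (ae_filterI fd fc); apply: ae_filterS => t [ft ft'] tI.
  by rewrite -ft// ft'// subrr.
have I_0 : I0L L 0 by rewrite /I0L /= in_itv/= lexx ltW.
have I_L : I0L L L by rewrite /I0L /= in_itv/= lexx ltW.
have c0 : c = 0 by have := diff0 0 I_0; rewrite d0 prim0 add0r.
split; first by rewrite -dL diff0// c0 addr0.
by move: fc; apply: ae_filterS => x + xI => /(_ xI); rewrite c0 addr0.
Qed.

Lemma weak_integration_by_parts L w h g gx gxx : 0 < L ->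
  L2 L w -> L2 L h -> weak_deriv2 L w h -> H02_with L g gx gxx ->
  inner L h g = inner L w gxx.
Proof.
move=> L0 w2 h2 wh [g2 [gx2 [gxx2 [ggx [gxgxx [g0 gx0]]]]]].
have L_ge0 := ltW L0.
have hw := L2_integ w2; have hh := L2_integ h2; have hg := L2_integ g2.
have hgx := L2_integ gx2; have hgxx := L2_integ gxx2.
have [primgx gE] := vanishes_at_ends_prim L0 hg hgx ggx g0.
have [primgxx gxE] := vanishes_at_ends_prim L0 hgx hgxx gxgxx gx0.
have [a [b wE]] := weak_deriv2_prim L0 hw hh wh.
have prim_integ f : integ L f -> integ L (prim f).
  by move=> hf; apply/integ_continuous/continuous_prim.
have hP := prim_integ _ hh; have hP2 := prim_integ _ hP.
have hK := prim_integ _ hgxx; have hG := prim_integ _ hgx.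
have cP2 := continuous_prim L_ge0 hP.
have hid := integ_id L; have h1 := integ_cst L 1.
have i0 : integ L (fun x => gxx x * prim (prim h) x) by exact: integ_mulr.
have i1 : integ L (fun x => gxx x * prim (cst 1) x).
  by apply: integ_mulr => //; exact: continuous_prim.
(* [iall] concerns gxx times (prim (prim h) x + a x + b), which represents w gxx. Here x appears as
   [prim (cst 1) x], and a as 1 + (a - 1). *)
have ia := integ_lin (a - 1) i1 i1.
have iab := integ_lin b ia hgxx.
have iall := integ_lin 1 i0 iab.
(* The integral of g' over [0, L] is g(L) = 0. *)
have Jgx : integral0L L (fun x => cst 1 x * prim gxx x) = 0.
  rewrite -[RHS]primgx; apply: ae_eq_integral0L => //.
    by apply: integ_mulr => //; exact: continuous_prim.
  by move: gxE; apply: ae_filterS => x gxE /gxE ->; rewrite mul1r.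
have Jx : integral0L L (fun x => gxx x * prim (cst 1) x) = 0.
  rewrite (eq_integral0L (g := fun x => prim (cst 1) x * gxx x)).
    by rewrite integral0L_prim// primgxx mulr0 Jgx subr0.
  by move=> x _; rewrite mulrC.
(* Two integrations by parts move the primitives from h onto gxx. The boundary terms contain g'(L)
   and g(L), both 0, and the two signs cancel. *)
have Jh : integral0L L (fun x => gxx x * prim (prim h) x) =
          integral0L L (fun x => h x * g x).
  rewrite (eq_integral0L (g := fun x => prim (prim h) x * gxx x)); last first.
    by move=> x _; rewrite mulrC.
  rewrite integral0L_prim// primgxx mulr0 sub0r.
  rewrite (ae_eq_integral0L (g := fun x => prim h x * gx x)).
  - rewrite integral0L_prim// primgx mulr0 sub0r opprK.
    apply: ae_eq_integral0L.
    + by apply: integ_mulr => //; exact: continuous_prim.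
    + exact: L2_mul.
    + by move: gE; apply: ae_filterS => x gE /gE ->.
  - by apply: integ_mulr => //; exact: continuous_prim.
  - rewrite (_ : (fun x => _) = fun x => gx x * prim h x); last first.
      by apply/funext => x; rewrite mulrC.
    by apply: integ_mulr => //; exact: continuous_prim.
  - by move: gxE; apply: ae_filterS => x gxE /gxE ->.
rewrite -[LHS]/(integral0L L (fun x => h x * g x)).
rewrite -[RHS]/(integral0L L (fun x => w x * gxx x)) -Jh.
apply/esym; rewrite (ae_eq_integral0L _ iall).
- rewrite !integral0L_lin// Jx -[integral0L L gxx]/(prim gxx L) primgxx; ring.
- exact: L2_mul.
- move: wE; apply: ae_filterS => x wE xI; rewrite wE//.
  move: xI; rewrite /I0L /= in_itv/= => /andP[x0 _].
  rewrite prim_cst1//; ring.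
Qed.

(** * The discrete scheme *)

(** Midpoint concavity of x^s is read off from convexity of its inverse x^(1/s), by applying the
    increasing map x^s at the end. *)
Lemma powR_natS_concave (s : R) (j : nat) : 0 < s -> s < 1 ->
  powR j%:R s + powR j.+2%:R s <= 2 * powR j.+1%:R s.
Proof.
move=> s0 s1; have si : 1 <= s^-1 by rewrite -[leLHS]invr1 lef_pV2 ?posrE// ltW.
have key (x : R) : 0 <= x -> powR (powR x s) s^-1 = x.
  by move=> x0; rewrite -powRrM mulfV ?gt_eqF// powRr1.
pose a := powR (j%:R : R) s; pose c := powR (j.+2%:R : R) s.
have h0 : 0 <= 2^-1 :> R by lra.
have h1 : 2^-1 <= 1 :> R by lra.
have mid : powR (2^-1 * a + 2^-1 * c) s^-1 <= j.+1%:R.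
  have aI : a \in (`[0, +oo[ : set R) by rewrite inE/= in_itv/= powR_ge0.
  have cI : c \in (`[0, +oo[ : set R) by rewrite inE/= in_itv/= powR_ge0.
  (* convexity of the inverse power x^(1/s) at the midpoint of j^s and (j+2)^s *)
  have half : 1 - 2^-1 = 2^-1 :> R by field.
  have h := convex_powR si (Itv01 h0 h1) aI cI.
  rewrite [X in powR X _ <= _]convRE [X in _ <= X]convRE /= /unstable.onem half in h.
  apply: le_trans h _; rewrite /a /c !key ?ler0n//.
  by rewrite -mulrDr -natrD ler_pdivrMl// -natrM ler_nat; lia.
rewrite -/a -/c.
have ac0 : 0 <= 2^-1 * a + 2^-1 * c by rewrite addr_ge0// mulr_ge0 ?powR_ge0.
have := ge0_ler_powR (ltW s0) (powR_ge0 _ _) _ mid; rewrite nnegrE ler0n => /(_ isT).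
rewrite -powRrM mulVf ?gt_eqF// powRr1//; lra.
Qed.

Lemma bcoef_ge0 gamma j : gamma < 1 -> 0 <= bcoef gamma j :> R.
Proof.
move=> g1; rewrite /bcoef subr_ge0 ge0_ler_powR ?nnegrE ?subr_ge0 ?ler_nat//; exact: ltW.
Qed.

(** Since [powR 0 0] is 1, the exponent 1 - gamma must be nonzero. The value b_0 = 1 turns the
    weight 1 - b_1 into b_0 - b_1. *)
Lemma bcoef0 gamma : gamma < 1 -> bcoef gamma 0 = 1 :> R.
Proof. by move=> g1; rewrite /bcoef powR1 powR0 ?subr0// subr_eq0 gt_eqF. Qed.

(** The difference b_j - b_(j+1) is minus the second difference of x^(1-gamma) at j, j+1, j+2. *)
Lemma bcoef_decr gamma j : 0 < gamma -> gamma < 1 ->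
  bcoef gamma j.+1 <= bcoef gamma j :> R.
Proof.
move=> g0 g1; have := @powR_natS_concave (1 - gamma) j; rewrite /bcoef.
rewrite subr_gt0 => /(_ g1); rewrite ltrBlDr ltrDl => /(_ g0); lra.
Qed.

(** The quadratic t -> <f + t g, f + t g> is nonnegative. *)
Lemma cauchy_schwarz_inner L f g : L2 L f -> L2 L g ->
  inner L f g <= norm0 L f * norm0 L g.
Proof.
move=> hf hg; have ff := L2_mul hf hf; have gg := L2_mul hg hg; have fg := L2_mul hf hg.
have inner_ge0 h : 0 <= inner L h h.
  by apply: Rintegral_ge0 => x _; rewrite -expr2 sqr_ge0.
have quad t : 0 <= inner L f f + 2 * t * inner L f g + t ^+ 2 * inner L g g.
  have := inner_ge0 (fun x => f x + t * g x).
  rewrite -[inner L _ _]/(integral0L L _).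
  rewrite (eq_integral0L (g := fun x => (f x * f x + (2 * t) * (f x * g x))
    + t ^+ 2 * (g x * g x))); last by move=> x _; ring.
  by rewrite !integral0L_lin//; exact: integ_lin.
have sq : inner L f g ^+ 2 <= inner L f f * inner L g g.
  have := inner_ge0 g; rewrite le_eqVlt => /predU1P[g0|g0].
    have [->|fgn0] := eqVneq (inner L f g) 0.
      by rewrite expr0n/= mulr_ge0.
    (* When <g, g> = 0 the quadratic is affine in t, and this t would give it the value -1. *)
    have := quad (- (inner L f f + 1) / (2 * inner L f g)).
    rewrite -g0 mulr0 addr0 (_ : _ * _ * _ = - (inner L f f + 1)); last by field.
    by rewrite opprD addNKr ler0N1.
  (* The minimizer of the quadratic. *)
  have := quad (- inner L f g / inner L g g).
  rewrite (_ : _ + _ = inner L f f - inner L f g ^+ 2 / inner L g g); last first.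
    by field; rewrite gt_eqF.
  by rewrite subr_ge0 ler_pdivrMr.
rewrite /norm0 -sqrtrM//; apply: le_trans (ler_norm _) _.
by rewrite -sqrtr_sqr ler_sqrt// mulr_ge0.
Qed.

(** Here e^2 <= m n <= m e, and e cancels unless it is 0. *)
Lemma le_of_sqr_le (e m n : R) : 0 <= e -> 0 <= m -> 0 <= n -> n <= e ->
  e ^+ 2 <= m * n -> e <= m.
Proof.
move=> e0 m0 n0 ne; rewrite le_eqVlt in e0; case/predU1P: e0 => [<-//|e0] h.
rewrite -(ler_pM2r e0) -expr2; apply: le_trans h _.
by rewrite ler_wpM2l.
Qed.

Lemma norm0_ge0 L f : 0 <= norm0 L f.
Proof. exact: sqrtr_ge0. Qed.

Lemma norm0_sqr L f : norm0 L f ^+ 2 = inner L f f.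
Proof.
by rewrite sqr_sqrtr//; apply: Rintegral_ge0 => x _; rewrite -expr2 sqr_ge0.
Qed.

Lemma norm2_sqr L beta alpha f fxx : 0 <= beta * alpha ->
  norm2 L beta alpha f fxx ^+ 2 = inner L f f + beta * alpha * inner L fxx fxx.
Proof.
move=> ba; rewrite -!norm0_sqr sqr_sqrtr//.
by rewrite addr_ge0 ?sqr_ge0// mulr_ge0// sqr_ge0.
Qed.

Lemma norm0_le_norm2 L beta alpha f fxx : 0 <= beta * alpha ->
  norm0 L f <= norm2 L beta alpha f fxx.
Proof.
move=> ba; rewrite -(@ler_pXn2r _ 2) ?nnegrE ?sqrtr_ge0//.
by rewrite norm2_sqr// norm0_sqr lerDl mulr_ge0// -norm0_sqr sqr_ge0.
Qed.

Lemma sum_bcoef gamma p : (0 < p)%N ->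
  1 - bcoef gamma 1 + \sum_(1 <= j < p) (bcoef gamma j - bcoef gamma j.+1)
  + bcoef gamma p = 1 :> R.
Proof.
elim: p => [//|[|p] IH _]; first by rewrite big_geq// addr0 subrK.
by rewrite big_nat_recr//= -[RHS](IH isT); ring.
Qed.

End Sobolev.

(** * The stability estimate *)

Theorem theorem1 (R : realType) (L gamma alpha dt : R) (K : nat)
  (y0 : R -> R) (u y yx yxx yxxxx : nat -> R -> R) :
  0 < L -> 0 < gamma -> gamma < 1 -> 0 < alpha -> (1 <= K)%N -> 0 < dt ->
  let beta := Gamma (2 - gamma) * powR dt gamma in
  L2 L y0 ->
  (forall j, (1 <= j <= K)%N -> L2 L (u j)) ->
  (forall j, (1 <= j <= K)%N ->
     H02_with L (y j) (yx j) (yxx j) /\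
     weak_deriv2 L (yxx j) (yxxxx j) /\ L2 L (yxxxx j)) ->
  (forall g, H02 L g ->
     inner L (y 1%N) g + beta * alpha * inner L (yxxxx 1%N) g
     = inner L y0 g + beta * inner L (u 1%N) g) ->
  (forall p, (1 <= p <= K - 1)%N -> forall g, H02 L g ->
     inner L (y p.+1) g + beta * alpha * inner L (yxxxx p.+1) g
     = (1 - bcoef gamma 1) * inner L (y p) g
       + \sum_(1 <= j < p) (bcoef gamma j - bcoef gamma j.+1) * inner L (y (p - j)%N) g
       + bcoef gamma p * inner L y0 g
       + beta * inner L (u p.+1) g) ->
  forall p, (p <= K - 1)%N ->
    norm2 L beta alpha (y p.+1) (yxx p.+1)
    <= norm0 L y0 + beta * \sum_(1 <= j < p.+2) norm0 L (u j).
Proof.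
move=> L0 g0 g1 alpha0 K1 dt0 beta y02 u2 yH eq1 eqS.
have beta0 : 0 <= beta.
  rewrite /beta mulr_ge0 ?powR_ge0//; apply: Rintegral_ge0 => t _.
  by rewrite mulr_ge0 ?powR_ge0 ?expR_ge0.
have ba0 : 0 <= beta * alpha by rewrite mulr_ge0// ltW.
have y2 j : (1 <= j <= K)%N -> L2 L (y j) by move=> /yH[[]].
have yH02 j : (1 <= j <= K)%N -> H02 L (y j).
  by move=> /yH[h _]; exists (yx j), (yxx j).
have energy j : (1 <= j <= K)%N -> norm2 L beta alpha (y j) (yxx j) ^+ 2 =
    inner L (y j) (y j) + beta * alpha * inner L (yxxxx j) (y j).
  move=> /yH[h [wd h4]]; rewrite norm2_sqr//.
  by rewrite (weak_integration_by_parts L0 _ h4 wd h)//; case: h => _ [_ []].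
(* The sum runs up to j = p, so the claim for y^(p+1) is the bound by [M p.+1], and [M 0] is the
   norm of y^0. *)
pose M p := norm0 L y0 + beta * \sum_(1 <= j < p.+1) norm0 L (u j).
have MS p : M p.+1 = M p + beta * norm0 L (u p.+1).
  by rewrite /M big_nat_recr//= mulrDr addrA.
have M_mono : {homo M : p q / (p <= q)%N >-> p <= q}.
  apply: homo_leq => //; first exact: le_trans.
  by move=> p; rewrite MS lerDl mulr_ge0// norm0_ge0.
have M0 : M 0%N = norm0 L y0 by rewrite /M big_geq// mulr0 addr0.
have M_ge0 p : 0 <= M p.
  by apply: le_trans (M_mono _ _ (leq0n p)); rewrite M0 norm0_ge0.
move=> p; rewrite -/(M p.+1).
elim/ltn_ind: p => p IH pK.
have p1K : (1 <= p.+1 <= K)%N by lia.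
have yn0 := norm0_ge0 L (y p.+1).
apply: (le_of_sqr_le (sqrtr_ge0 _) (M_ge0 _) yn0 (norm0_le_norm2 _ _ _ ba0)).
rewrite energy// MS mulrDl.
have CSu : beta * inner L (u p.+1) (y p.+1) <= beta * norm0 L (u p.+1) * norm0 L (y p.+1).
  by rewrite -mulrA ler_wpM2l//; apply: cauchy_schwarz_inner; [exact: u2|exact: y2].
have CS0 q : (q <= p)%N -> inner L y0 (y p.+1) <= M q * norm0 L (y p.+1).
  move=> _; apply: le_trans (cauchy_schwarz_inner y02 (y2 _ p1K)) _.
  by rewrite ler_wpM2r// -M0 M_mono.
(* For 1 <= q <= p, |y^q|_0 <= |y^q|_2 <= M q <= M p; the induction hypothesis is used at index q -
   1. *)
have CSy q : (1 <= q <= p)%N -> inner L (y q) (y p.+1) <= M p * norm0 L (y p.+1).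
  move=> qp; have qK : (1 <= q <= K)%N by clear -qp p1K; lia.
  apply: le_trans (cauchy_schwarz_inner (y2 _ qK) (y2 _ p1K)) _.
  rewrite ler_wpM2r//; apply: le_trans (norm0_le_norm2 _ _ (yxx q) ba0) _.
  apply: (@le_trans _ _ (M q)); last by apply: M_mono; case/andP: qp.
  by case: q qp {qK} => // q qp; apply: IH; clear -qp pK; lia.
have [p_eq0|p_gt0] := posnP p.
  move: p1K CSu CS0 {CSy}; rewrite p_eq0 => p1K CSu CS0.
  by rewrite eq1 ?lerD ?CS0//; exact: yH02.
rewrite eqS; [|by rewrite p_gt0|exact: yH02].
rewrite lerD//.
(* The factor 1 is replaced by the sum of the weights, after which both sides are compared term by
   term. *)
rewrite -[leRHS]mul1r -[X in _ <= X * _](sum_bcoef gamma p_gt0).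
rewrite [leRHS]mulrDl [X in _ <= X + _]mulrDl mulr_suml.
apply: lerD; first apply: lerD.
- rewrite ler_wpM2l//; last by apply: CSy; rewrite p_gt0/=.
  by rewrite subr_ge0 -(bcoef0 g1) bcoef_decr.
- rewrite [leLHS]big_nat_cond [leRHS]big_nat_cond; apply: ler_sum => j /andP[jp _].
  by rewrite ler_wpM2l ?subr_ge0 ?bcoef_decr//; apply: CSy; clear -jp; lia.
- by rewrite ler_wpM2l ?bcoef_ge0//; exact: CS0.
Qed.
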